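(* An interval linear program with degenerated matrix has strongly zero duality gap if and only if the primal interval linear program or its dual interval linear program is strongly feasible.
   Context: For real matrices $\underline{A}\le\overline{A}$ in $\mathbb{R}^{m\times n}$ (entrywise order), the interval matrix $\mathbf{A}=[\underline{A},\overline{A}]$ is the set $\{A\in\mathbb{R}^{m\times n}:\underline{A}\le A\le\overline{A}\}$; interval vectors $\mathbf{b}=[\underline b,\overline b]\subseteq\mathbb{R}^m$ and $\mathbf{c}=[\underline c,\overline c]\subseteq\mathbb{R}^n$ are defined analogously. An interval linear program (ILP) is the family of linear programs $\min\{c^{\top}x : x\in\mathcal{M}(A,b)\}$ with $A\in\mathbf{A}$, $b\in\mathbf{b}$, $c\in\mathbf{c}$, where $\mathcal{M}(A,b)\subseteq\mathbb{R}^n$ is described by linear equations and inequalities of a fixed form: each row is of the form $(Ax)_i=b_i$, $(Ax)_i\le b_i$ or $(Ax)_i\ge b_i$, and each variable is free, nonnegative or nonpositive, the same pattern being used for all $(A,b,c)$. A choice $(A,b,c)$ with $A\in\mathbf{A},b\in\mathbf{b},c\in\mathbf{c}$ is called a scenario. The dual ILP is the family of the usual linear programming duals of the scenarios: $\max b^{\top}y$ with $y_i$ free, $\le 0$, $\ge 0$ according to whether row $i$ is an equation, a $\le$ or a $\ge$ inequality, and with $(A^{\top}y)_j= c_j$, $\le c_j$, $\ge c_j$ according to whether $x_j$ is free, nonnegative, nonpositive. An ILP (primal or dual) is strongly feasible if it is feasible for all scenarios. The ILP has degenerated matrix if $\underline{A}=\overline{A}$, i.e. the constraint matrix is a single real matrix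 $A$, while $\mathbf{b}$ and $\mathbf{c}$ may be intervals. The duality gap of a linear program is the difference between the primal and dual optimal values; it is zero if and only if at least one of the primal or the dual program is feasible, and it is $\infty$ otherwise. The duality gap of the ILP is strongly zero if all scenarios have zero duality gap. *)

(* Defs.v *)
From HB Require Import structures.
From mathcomp Require Import all_boot all_order all_algebra.
From mathcomp Require Import all_classical all_reals all_analysis.

Set Implicit Arguments.
Unset Strict Implicit.
Unset Printing Implicit Defensive.

Import Order.TTheory GRing.Theory Num.Theory.
Local Open Scope classical_set_scope.
Local Open Scope ring_scope.

Inductive row_type := RowEq | RowLe | RowGe.
Inductive var_type := VarFree | VarNonneg | VarNonpos.

Definition row_holds (R : realType) (r : row_type) (s t : R) : bool :=
  match r with
  | RowEq => s == t
  | RowLe => s <= t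
  | RowGe => s >= t
  end.

Definition var_holds (R : realType) (v : var_type) (s : R) : bool :=
  match v with
  | VarFree => true
  | VarNonneg => 0 <= s
  | VarNonpos => s <= 0
  end.

Record lp_form (m n : nat) := LPForm {
  row_form : 'I_m -> row_type;
  var_form : 'I_n -> var_type
}.

Definition dual_var (r : row_type) : var_type :=
  match r with
  | RowEq => VarFree
  | RowLe => VarNonpos
  | RowGe => VarNonneg
  end.

Definition dual_row (v : var_type) : row_type :=
  match v with
  | VarFree => RowEq
  | VarNonneg => RowLe
  | VarNonpos => RowGe
  end.

Definition dual_form (m n : nat) (F : lp_form m n) : lp_form n m :=
  LPForm (fun j => dual_row (var_form F j)) (fun i => dual_var (row_form F i)).

Definition feasible_set (R : realType) (m n : nat) (F : lp_form m n)
    (A : 'M[R]_(m, n)) (b : 'cV[R]_m) : set 'cV[R]_n :=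
  [set x | (forall i, row_holds (row_form F i) ((A *m x) i 0) (b i 0)) /\
           (forall j, var_holds (var_form F j) (x j 0))].

Definition dual_feasible_set (R : realType) (m n : nat) (F : lp_form m n)
    (A : 'M[R]_(m, n)) (c : 'cV[R]_n) : set 'cV[R]_m :=
  feasible_set (dual_form F) A^T c.

(* Usual conventions for optimal values: the infimum over the empty set is +oo
   and the supremum over the empty set is -oo. *)
Definition primal_value (R : realType) (m n : nat) (F : lp_form m n)
    (A : 'M[R]_(m, n)) (b : 'cV[R]_m) (c : 'cV[R]_n) : \bar R :=
  ereal_inf [set ((c^T *m x) 0 0)%:E | x in feasible_set F A b].

Definition dual_value (R : realType) (m n : nat) (F : lp_form m n)
    (A : 'M[R]_(m, n)) (b : 'cV[R]_m) (c : 'cV[R]_n) : \bar R :=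
  ereal_sup [set ((b^T *m y) 0 0)%:E | y in dual_feasible_set F A c].

(* The case split is needed because the library sets +oo - +oo = -oo, whereas
   a linear program whose primal and dual values are the same infinity (one of
   the two is unbounded, the other one infeasible) has zero duality gap.  When
   both are infeasible the gap is +oo - -oo = +oo. *)
Definition duality_gap (R : realType) (m n : nat) (F : lp_form m n)
    (A : 'M[R]_(m, n)) (b : 'cV[R]_m) (c : 'cV[R]_n) : \bar R :=
  if primal_value F A b c == dual_value F A b c then 0%E
  else (primal_value F A b c - dual_value F A b c)%E.

Definition le_mx (R : realType) (m n : nat) (A B : 'M[R]_(m, n)) : Prop :=
  forall i j, A i j <= B i j.

Definition interval_mx (R : realType) (m n : nat) (lo hi : 'M[R]_(m, n)) :
    set 'M[R]_(m, n) :=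
  [set A | le_mx lo A /\ le_mx A hi].

Record ilp (R : realType) (m n : nat) := ILP {
  ilp_form : lp_form m n;
  A_lo : 'M[R]_(m, n);
  A_hi : 'M[R]_(m, n);
  b_lo : 'cV[R]_m;
  b_hi : 'cV[R]_m;
  c_lo : 'cV[R]_n;
  c_hi : 'cV[R]_n;
  A_le : le_mx A_lo A_hi;
  b_le : le_mx b_lo b_hi;
  c_le : le_mx c_lo c_hi
}.

Definition scenario (R : realType) (m n : nat) (P : ilp R m n)
    (A : 'M[R]_(m, n)) (b : 'cV[R]_m) (c : 'cV[R]_n) : Prop :=
  [/\ interval_mx (A_lo P) (A_hi P) A,
      interval_mx (b_lo P) (b_hi P) b &
      interval_mx (c_lo P) (c_hi P) c].

Definition primal_strongly_feasible (R : realType) (m n : nat)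
    (P : ilp R m n) : Prop :=
  forall A b c, scenario P A b c -> feasible_set (ilp_form P) A b !=set0.

Definition dual_strongly_feasible (R : realType) (m n : nat)
    (P : ilp R m n) : Prop :=
  forall A b c, scenario P A b c -> dual_feasible_set (ilp_form P) A c !=set0.

Definition strongly_zero_gap (R : realType) (m n : nat)
    (P : ilp R m n) : Prop :=
  forall A b c, scenario P A b c -> duality_gap (ilp_form P) A b c = 0%E.

Definition degenerated_matrix (R : realType) (m n : nat)
    (P : ilp R m n) : Prop :=
  A_lo P = A_hi P.

(* Main.v *)
Require Import Defs.
From HB Require Import structures.
From mathcomp Require Import all_boot all_order all_algebra.
From mathcomp Require Import all_classical all_reals all_analysis.
From mathcomp Require Import ring lra.

(** Everything rests on linear programming duality: as soon as one of the two
programs of a scenario is feasible, their values coincide, whereas if both are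
infeasible the values are +oo and -oo.  So a strongly feasible ILP, primal or
dual, has strongly zero gap.  Conversely, if neither is strongly feasible, then
some b makes the primal infeasible and some c makes the dual infeasible; with a
single matrix, primal feasibility depends on b alone and dual feasibility on c
alone, so the scenario combining this b with this c has an infinite gap.

Duality is derived from Farkas' lemma ([farkas]), proved by Bartl's induction
on the number of inequalities, which needs neither closedness of cones nor
elimination of variables.  A lower bound v of the objective over a nonempty
feasible set is a linear inequality valid on the homogenized feasible cone;
Farkas' lemma puts it in the cone generated by the constraints, and the
coefficients of such a combination form a dual solution of value at least v
([dual_certificate]).  The dual being itself a linear program, the same lemma
also covers the scenarios whose dual is feasible ([primal_certificate]). *)

Set Implicit Arguments.
Unset Strict Implicit.
Unset Printing Implicit Defensive.

Import Order.TTheory GRing.Theory Num.Theory.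
Local Open Scope classical_set_scope.
Local Open Scope ring_scope.

Local Notation dot u v := ((u^T *m v) 0 0).

(** * The standard pairing of column vectors *)

Section Dot.
Variables (R : realFieldType) (N : nat).
Implicit Types u v w : 'cV[R]_N.

Lemma dotE u v : dot u v = \sum_i u i 0 * v i 0.
Proof. by rewrite mxE; apply: eq_bigr => i _; rewrite mxE. Qed.

Lemma dotC u v : dot u v = dot v u.
Proof. by rewrite !dotE; apply: eq_bigr => i _; rewrite mulrC. Qed.

Lemma dotDl u v w : dot (u + v) w = dot u w + dot v w.
Proof. by rewrite linearD mulmxDl mxE. Qed.

Lemma dotZl a u w : dot (a *: u) w = a * dot u w.
Proof. by rewrite linearZ -scalemxAl mxE. Qed.

Lemma dotDr u v w : dot w (u + v) = dot w u + dot w v.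
Proof. by rewrite mulmxDr mxE. Qed.

Lemma dotZr a u w : dot w (a *: u) = a * dot w u.
Proof. by rewrite -scalemxAr mxE. Qed.

Lemma dotNl u w : dot (- u) w = - dot u w.
Proof. by rewrite -scaleN1r dotZl mulN1r. Qed.

Lemma dotNr u w : dot w (- u) = - dot w u.
Proof. by rewrite -scaleN1r dotZr mulN1r. Qed.

Lemma dot_delta u i : dot (delta_mx i 0 : 'cV[R]_N) u = u i 0.
Proof. by rewrite trmx_delta -rowE mxE. Qed.

Lemma dot_ge0_eq0 u : (forall x : 'cV[R]_N, 0 <= dot u x) -> u = 0.
Proof.
move=> u_ge0; apply/colP => i; rewrite [RHS]mxE; apply/eqP; rewrite eq_le.
have := u_ge0 (delta_mx i 0 : 'cV[R]_N); have := u_ge0 (- delta_mx i 0 : 'cV[R]_N).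
by rewrite dotNr !(dotC u) dot_delta oppr_ge0 => -> ->.
Qed.

End Dot.

Lemma dot_mulmx (R : realFieldType) (m n : nat) (A : 'M[R]_(m, n))
    (x : 'cV[R]_n) (y : 'cV[R]_m) : dot (A *m x) y = dot x (A^T *m y).
Proof. by rewrite trmx_mul mulmxA. Qed.

Lemma dot_col_mx (R : realFieldType) (m n : nat) (u1 v1 : 'cV[R]_m)
    (u2 v2 : 'cV[R]_n) :
  dot (col_mx u1 u2) (col_mx v1 v2) = dot u1 v1 + dot u2 v2.
Proof. by rewrite tr_col_mx mul_row_col mxE. Qed.

(** * Farkas' lemma *)

Record convex_cone (R : realFieldType) (N : nat) (K : set 'cV[R]_N) : Prop :=
  ConvexCone {
  cone0 : K 0;
  coneD : forall u v, K u -> K v -> K (u + v);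
  coneZ : forall a u, 0 <= a -> K u -> K (a *: u)
}.

(** Quantifying over all convex cones that contain the vectors of [s] amounts
to speaking of the cone generated by [s], but lets the multipliers remain
implicit.  In the induction step, either [a] is superfluous, or some [x0]
satisfies the inequalities of [s] and violates that of [g], hence also that of
[a].  Projecting along [x0] onto the hyperplane orthogonal to [a] then removes
[a] from the system. *)
Lemma farkas (R : realFieldType) (N : nat) (s : seq 'cV[R]_N) (g : 'cV[R]_N)
    (K : set 'cV[R]_N) :
  convex_cone K -> (forall a, a \in s -> K a) ->
  (forall x : 'cV[R]_N, (forall a, a \in s -> 0 <= dot a x) -> 0 <= dot g x) ->
  K g.
Proof.
have [k] := ubnP (size s); elim: k => // k IHk in s g K *.
case: s => [|a s] /= ltsk coneK sK s_g.
  rewrite (@dot_ge0_eq0 _ _ g); first exact: cone0.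
  by move=> x; apply: s_g.
have Ka : K a by apply: sK; rewrite mem_head.
have sK' b : b \in s -> K b by move=> sb; apply: sK; rewrite in_cons sb orbT.
have [s_g'|] := pselect
    (forall x : 'cV[R]_N, (forall b, b \in s -> 0 <= dot b x) -> 0 <= dot g x).
  exact: IHk s_g'.
move=> /existsNP[x0 /not_implyP[x0s /negP]]; rewrite -ltNge => gx0.
have ax0 : dot a x0 < 0.
  rewrite ltNge; apply/negP => ax0; have := s_g x0.
  rewrite leNgt gx0 => /(_ _)/negP; apply => // b.
  by rewrite in_cons => /predU1P[->|/x0s].
pose p (b : 'cV[R]_N) := b - (dot b x0 / dot a x0) *: a.
have dot_p b x : dot (p b) x = dot b (x - (dot a x / dot a x0) *: x0).
  rewrite dotDl dotNl dotZl dotDr dotNr dotZr; field.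
  by rewrite lt_eqF.
(* K' consists of the vectors that stay in K however much of a is added.  It
   contains p b for b in s, because p b is b plus a nonnegative multiple of a,
   and from p g one recovers g by adding a positive multiple of a. *)
pose K' : set 'cV[R]_N := [set v | forall t, 0 <= t -> K (v + t *: a)].
have coneK' : convex_cone K'.
  split=> [t t0|u v K'u K'v t t0|r u r0 K'u t t0].
  - by rewrite add0r; apply: coneZ.
  - have := coneD coneK (K'u 0 (lexx 0)) (K'v t t0).
    by rewrite scale0r addr0 addrA.
  - move: r0; rewrite le_eqVlt => /predU1P[<-|r0].
      by rewrite scale0r add0r; apply: coneZ.
    rewrite -[t](mulfVK (lt0r_neq0 r0)) mulrC -scalerA -scalerDr.
    by apply: coneZ => //; [apply: ltW|apply: K'u; rewrite divr_ge0 // ltW].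
have K'pg : K' (p g).
  apply: (IHk (map p s)) => //; first by rewrite size_map.
    move=> _ /mapP[b sb ->] t t0; rewrite /p -addrA -scaleNr -scalerDl.
    apply: coneD => //; first exact: sK'.
    apply: coneZ => //; rewrite addr_ge0 // -mulrN mulr_ge0 ?x0s //.
    by rewrite oppr_ge0 invr_le0 ltW.
  move=> x psx; rewrite dot_p; apply: s_g => b.
  rewrite in_cons => /predU1P[->|sb].
    by rewrite dotDr dotNr dotZr mulfVK ?lt_eqF // subrr.
  by rewrite -dot_p; apply/psx/map_f.
rewrite -[g](subrK ((dot g x0 / dot a x0) *: a)).
by apply: K'pg; rewrite -mulrNN mulr_ge0 // oppr_ge0 ?invr_le0 ltW.
Qed.

(** * Duality for linear programs in general form *)

Section Duality.
Variables (R : realType).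

Lemma row_var_weak (r : row_type) (s t y : R) :
  row_holds r s t -> var_holds (dual_var r) y -> t * y <= s * y.
Proof.
case: r => /=; first by move=> /eqP->.
- by move=> st y0; rewrite ler_wnM2r.
- by move=> st y0; rewrite ler_wpM2r.
Qed.

Lemma var_row_weak (v : var_type) (s t x : R) :
  var_holds v x -> row_holds (dual_row v) s t -> s * x <= t * x.
Proof.
case: v => /=; first by move=> _ /eqP->.
- by move=> x0 st; rewrite ler_wpM2r.
- by move=> x0 st; rewrite ler_wnM2r.
Qed.

(** Both bounds are compared with the middle term y (A x) = (A^T y) x, one summand
at a time. *)
Lemma weak_duality (m n : nat) (F : lp_form m n) (A : 'M[R]_(m, n))
    (b : 'cV[R]_m) (c : 'cV[R]_n) x y :
  feasible_set F A b x -> dual_feasible_set F A c y -> dot b y <= dot c x.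
Proof.
move=> [Ax x_sgn] [Ay y_sgn]; apply: (@le_trans _ _ (dot (A *m x) y)).
  by rewrite !dotE; apply: ler_sum => i _; apply: row_var_weak (Ax i) (y_sgn i).
rewrite dot_mulmx dotC !dotE; apply: ler_sum => j _.
exact: var_row_weak (x_sgn j) (Ay j).
Qed.

Lemma row_holdsD (r : row_type) (s t s' t' : R) :
  row_holds r s t -> row_holds r s' t' -> row_holds r (s + s') (t + t').
Proof.
by case: r => /=; [move=> /eqP-> /eqP-> | apply: lerD | apply: lerD].
Qed.

Lemma row_holdsZ (r : row_type) (a s t : R) :
  0 <= a -> row_holds r s t -> row_holds r (a * s) (a * t).
Proof.
by move=> a0; case: r => /=; [move=> /eqP-> | apply: ler_wpM2l | apply: ler_wpM2l].
Qed.

Lemma var_holdsD (v : var_type) (s t : R) :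
  var_holds v s -> var_holds v t -> var_holds v (s + t).
Proof. by case: v => //= ? ?; lra. Qed.

Lemma var_holdsZ (v : var_type) (a s : R) :
  0 <= a -> var_holds v s -> var_holds v (a * s).
Proof. by move=> a0; case: v => //= ?; [apply: mulr_ge0 | apply: mulr_ge0_le0]. Qed.

Lemma row_holds_refl (r : row_type) (s : R) : row_holds r s s.
Proof. by case: r => /=. Qed.

Lemma var_holds0 (v : var_type) : var_holds v (0 : R).
Proof. by case: v => /=. Qed.

Lemma feasible0 (m n : nat) (F : lp_form m n) (A : 'M[R]_(m, n)) :
  feasible_set F A 0 0.
Proof.
by split=> i; rewrite ?mulmx0 !mxE ?row_holds_refl ?var_holds0.
Qed.

Lemma feasibleD (m n : nat) (F : lp_form m n) (A : 'M[R]_(m, n)) b b' x x' :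
  feasible_set F A b x -> feasible_set F A b' x' ->
  feasible_set F A (b + b') (x + x').
Proof.
move=> [Ax xs] [Ax' xs']; split=> i; last by rewrite mxE; apply: var_holdsD.
by rewrite mulmxDr [_ i 0]mxE [X in row_holds _ _ X]mxE; apply: row_holdsD.
Qed.

Lemma feasibleZ (m n : nat) (F : lp_form m n) (A : 'M[R]_(m, n)) a b x :
  0 <= a -> feasible_set F A b x -> feasible_set F A (a *: b) (a *: x).
Proof.
move=> a0 [Ax xs]; split=> i; last by rewrite mxE; apply: var_holdsZ.
by rewrite -scalemxAr [_ i 0]mxE [X in row_holds _ _ X]mxE; apply: row_holdsZ.
Qed.

(** An equation is the conjunction of two opposite inequalities.  Listing the
inequalities of a row by the signs that its dual variable may take treats the
three kinds of rows alike, and makes each listed inequality correspond to a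
vector that obeys the sign constraints of the dual. *)
Lemma row_holds_signs (r : row_type) (s t : R) :
  (forall e, e \in [:: 1; -1] -> var_holds (dual_var r) e -> 0 <= e * (s - t)) ->
  row_holds r s t.
Proof.
move=> H; have := H 1; have := H (- 1); rewrite !inE !eqxx !orbT !mul1r !mulN1r.
rewrite oppr_ge0 subr_ge0 subr_le0.
case: r {H} => /=.
- by move=> /(_ isT isT) st /(_ isT isT) ts; rewrite eq_le st ts.
- by move=> /(_ isT (lerN10 _)).
- by move=> _ /(_ isT ler01).
Qed.

(** Dually, the sign constraint on a variable is listed by the coefficients that
the zero left-hand side allows in the corresponding row of the dual. *)
Lemma var_holds_signs (v : var_type) (s : R) :
  (forall e, e \in [:: 1; -1] -> row_holds (dual_row v) 0 e -> 0 <= e * s) ->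
  var_holds v s.
Proof.
move=> H; have := H 1; have := H (- 1); rewrite !inE !eqxx !orbT !mul1r !mulN1r.
rewrite oppr_ge0.
by case: v {H} => //= [_ /(_ isT ler01)|/(_ isT (lerN10 _))].
Qed.

Lemma row_holdsN (r : row_type) (s t : R) :
  row_holds (dual_row (dual_var r)) s (- t) -> row_holds r (- s) t.
Proof. by case: r => /= [/eqP->||] => [|?|?]; rewrite ?opprK //; lra. Qed.

Lemma var_holdsN (v : var_type) (s : R) :
  var_holds (dual_var (dual_row v)) s -> var_holds v (- s).
Proof. by case: v => //= ?; lra. Qed.

(** A point x feasible for the right-hand side [t *: b] may be moved by a small
multiple of a feasible point of the program itself and then rescaled; this also
covers t = 0, where x is a recession direction. *)
Lemma homogenized_bound (m n : nat) (F : lp_form m n) (A : 'M[R]_(m, n))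
    (b : 'cV[R]_m) (c : 'cV[R]_n) (v : R) :
  feasible_set F A b !=set0 ->
  (forall x, feasible_set F A b x -> v <= dot c x) ->
  forall t x, 0 <= t -> feasible_set F A (t *: b) x -> v * t <= dot c x.
Proof.
move=> [x0 x0P] vP t x t0 xP; rewrite leNgt; apply/negP => cx.
have cx0 := vP _ x0P.
(* This makes e * (c x0 - v), what is lost by moving, less than the supposed
   violation v * t - c x. *)
pose e := (v * t - dot c x) / (dot c x0 - v + 1).
have e1 : 0 < dot c x0 - v + 1 by lra.
have e0 : 0 < e by rewrite divr_gt0 // subr_gt0.
have te : 0 < t + e by lra.
have : feasible_set F A b ((t + e)^-1 *: (x + e *: x0)).
  have -> : b = (t + e)^-1 *: (t *: b + e *: b).
    by rewrite -scalerDl scalerA mulVf ?scale1r // gt_eqF.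
  apply: feasibleZ; first by rewrite invr_ge0 ltW.
  by apply: feasibleD => //; apply: feasibleZ => //; apply: ltW.
move=> /vP; rewrite dotZr dotDr dotZr mulrC ler_pdivlMr //.
have : e * (dot c x0 - v + 1) = v * t - dot c x by rewrite mulfVK // gt_eqF.
by lra.
Qed.

(** Farkas' lemma in the space of pairs (t, x), where the hypothesis says that
c x - v t >= 0 follows from the homogenized constraints ([homogenized_bound]):
these are t >= 0, the inequalities (A x)_i - t b_i >= 0 up to the signs admissible
for the dual variable i, and the sign constraints on x.  The cone K to which the
lemma is applied collects the inequalities w x + d t >= 0 that a dual vector y
proves: y is feasible for the objective w and d + b y >= 0 is the remaining
coefficient of t. *)
Lemma dual_certificate (m n : nat) (F : lp_form m n) (A : 'M[R]_(m, n))
    (b : 'cV[R]_m) (c : 'cV[R]_n) (v : R) :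
  feasible_set F A b !=set0 ->
  (forall x, feasible_set F A b x -> v <= dot c x) ->
  exists2 y, dual_feasible_set F A c y & v <= dot b y.
Proof.
move=> F0 vP.
pose K : set 'cV[R]_(1 + n) :=
  [set u | exists2 y, dual_feasible_set F A (dsubmx u) y
                    & - dot b y <= usubmx u 0 0].
have coneK : convex_cone K.
  split=> [|u u' [y yP yu] [y' y'P yu']|a u a0 [y yP yu]].
  - by exists 0; [rewrite linear0; apply: feasible0 | rewrite mulmx0 !mxE oppr0].
  - exists (y + y'); first by rewrite linearD; apply: feasibleD.
    by rewrite dotDr opprD linearD [leRHS]mxE lerD.
  - exists (a *: y); first by rewrite linearZ; apply: feasibleZ.
    by rewrite dotZr -mulrN linearZ [leRHS]mxE ler_wpM2l.
pose rowg (y : 'cV[R]_m) : 'cV[R]_(1 + n) := col_mx (- dot b y)%:M (A^T *m y).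
pose varg (w : 'cV[R]_n) : 'cV[R]_(1 + n) := col_mx 0 w.
pose s := col_mx 1%:M 0 ::
  [seq rowg (e *: delta_mx i 0) | i <- enum 'I_m,
     e <- [seq e <- [:: 1; -1] | var_holds (dual_var (row_form F i)) e]] ++
  [seq varg (e *: delta_mx j 0) | j <- enum 'I_n,
     e <- [seq e <- [:: 1; -1] | row_holds (dual_row (var_form F j)) 0 e]].
suff [y] : K (col_mx (- v)%:M c).
  by rewrite col_mxKd col_mxKu [X in _ <= X -> _]mxE mulr1n lerN2; exists y.
apply: (farkas (s := s)) => // [a|x].
  rewrite in_cons mem_cat => /or3P[/eqP->|/allpairsPdep|/allpairsPdep].
  - exists 0; first by rewrite col_mxKd; apply: feasible0.
    by rewrite mulmx0 col_mxKu !mxE oppr0 ler01.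
  - move=> [i [e [_ + ->]]]; rewrite mem_filter => /andP[ei _].
    exists (e *: delta_mx i 0); last by rewrite col_mxKu [leRHS]mxE mulr1n.
    rewrite col_mxKd; split=> k; first exact: row_holds_refl.
    rewrite !mxE eqxx andbT; case: eqVneq => [->|_]; first by rewrite mulr1.
    by rewrite mulr0 var_holds0.
  - move=> [j [e [_ + ->]]]; rewrite mem_filter => /andP[ej _].
    exists 0; last by rewrite col_mxKu mulmx0 !mxE oppr0.
    rewrite col_mxKd; split=> k; rewrite ?mulmx0 ?mxE ?var_holds0 //.
    rewrite eqxx andbT; case: eqVneq => [->|_]; first by rewrite mulr1.
    by rewrite mulr0 row_holds_refl.
rewrite -[x]vsubmxK; set t := usubmx x; set z := dsubmx x => tz.
have scal (a : R) : dot a%:M t = a * t 0 0 by rewrite tr_scalar_mx mul_scalar_mx mxE.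
have t0 : 0 <= t 0 0.
  have := tz (col_mx 1%:M 0); rewrite mem_head => /(_ isT).
  by rewrite dot_col_mx scal trmx0 mul0mx [X in _ + X]mxE mul1r addr0.
have zP : feasible_set F A (t 0 0 *: b) z.
  split=> [i|j]; [apply: row_holds_signs | apply: var_holds_signs] => e e1 eP.
    have : rowg (e *: delta_mx i 0) \in s.
      rewrite in_cons mem_cat; apply/or3P/Or32/allpairsPdep.
      by exists i, e; rewrite mem_enum mem_filter eP.
    move=> /tz; rewrite dot_col_mx scal dot_mulmx trmxK (dotC b) !dotZl !dot_delta.
    by rewrite [X in _ -> 0 <= _ * (_ - X)]mxE; congr (0 <= _); ring.
  have : varg (e *: delta_mx j 0) \in s.
    rewrite in_cons mem_cat; apply/or3P/Or33/allpairsPdep.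
    by exists j, e; rewrite mem_enum mem_filter eP.
  by move=> /tz; rewrite dot_col_mx trmx0 mul0mx [X in X + _]mxE add0r dotZl dot_delta.
rewrite dot_col_mx scal addrC mulNr subr_ge0.
have vt := homogenized_bound F0 vP t0 zP; exact: vt.
Qed.

(** Up to the sign of x, the dual of the dual is the primal, so that this is
[dual_certificate] for the minimization of - b y over the dual. *)
Lemma primal_certificate (m n : nat) (F : lp_form m n) (A : 'M[R]_(m, n))
    (b : 'cV[R]_m) (c : 'cV[R]_n) (v : R) :
  dual_feasible_set F A c !=set0 ->
  (forall y, dual_feasible_set F A c y -> dot b y <= v) ->
  exists2 x, feasible_set F A b x & dot c x <= v.
Proof.
move=> D0 vP.
have [y yP|x [xr xv] cx] := @dual_certificate _ _ _ A^T c (- b) (- v) D0.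
  by rewrite dotNl lerN2; apply: vP.
exists (- x); last by rewrite dotNr lerNl.
split=> [i|j].
  have := xr i; rewrite trmxK mulmxN ![X in row_holds _ _ X -> _]mxE.
  by rewrite [X in _ -> row_holds _ X _]mxE; apply: row_holdsN.
by have := xv j; rewrite [X in _ -> var_holds _ X]mxE; apply: var_holdsN.
Qed.

(** * Duality gaps *)

Lemma value_duality (m n : nat) (F : lp_form m n) (A : 'M[R]_(m, n))
    (b : 'cV[R]_m) (c : 'cV[R]_n) :
  feasible_set F A b !=set0 \/ dual_feasible_set F A c !=set0 ->
  primal_value F A b c = dual_value F A b c.
Proof.
move=> feas; apply/eqP; rewrite eq_le; apply/andP; split; last first.
  apply: ge_ereal_sup => _ [y yP <-]; apply: le_ereal_inf_tmp => _ [x xP <-].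
  by rewrite lee_fin; apply: weak_duality xP yP.
have pv x : feasible_set F A b x -> (primal_value F A b c <= (dot c x)%:E)%E.
  by move=> xP; apply: ereal_inf_lbound; exists x.
have dv y : dual_feasible_set F A c y -> ((dot b y)%:E <= dual_value F A b c)%E.
  by move=> yP; apply: ereal_sup_ubound; exists y.
case: feas => [F0|D0].
  case E : (primal_value F A b c) => [v||]; last by rewrite leNye.
    have [|y yP vy] := @dual_certificate _ _ F A b c v F0.
      by move=> x /pv; rewrite E lee_fin.
    by apply: le_trans (dv _ yP); rewrite lee_fin.
  by case: F0 => x /pv; rewrite E leye_eq.
case E : (dual_value F A b c) => [v||]; last 2 first.
- by rewrite leey.
- by case: D0 => y /dv; rewrite E leeNy_eq.
have [|x xP xv] := @primal_certificate _ _ F A b c v D0.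
  by move=> y /dv; rewrite E lee_fin.
by apply: le_trans (pv _ xP) _; rewrite lee_fin.
Qed.

Lemma duality_gap_eq0 (m n : nat) (F : lp_form m n) (A : 'M[R]_(m, n))
    (b : 'cV[R]_m) (c : 'cV[R]_n) :
  duality_gap F A b c = 0%E <->
  feasible_set F A b !=set0 \/ dual_feasible_set F A c !=set0.
Proof.
split=> [|/value_duality pd]; last by rewrite /duality_gap pd eqxx.
apply: contraPP => /not_orP[/set0P/negP/negPn/eqP F0 /set0P/negP/negPn/eqP D0].
rewrite /duality_gap /primal_value /dual_value F0 D0 !image_set0.
by rewrite ereal_inf0 ereal_sup0.
Qed.

End Duality.

Theorem theorem1 (R : realType) (m n : nat) (P : ilp R m n)
    (degP : degenerated_matrix P) :
  strongly_zero_gap P <->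
  primal_strongly_feasible P \/ dual_strongly_feasible P.
Proof.
split=> [gap0|[] feas A b c sc].
- apply: contrapT => /not_orP[/existsNP[A /existsNP[b /existsNP[c]]]].
  move=> /not_implyP[[Ai bi _] nF].
  move=> /existsNP[A' /existsNP[b' /existsNP[c' /not_implyP[[A'i _ c'i] nD]]]].
  have A_unique B : interval_mx (A_lo P) (A_hi P) B -> B = A_lo P.
    move=> [loB Bhi]; apply/matrixP => i j; apply/eqP.
    by rewrite eq_le loB andbT degP Bhi.
  rewrite (A_unique _ A'i) -(A_unique _ Ai) in nD.
  by have /duality_gap_eq0[] : duality_gap (ilp_form P) A b c' = 0%E by apply: gap0.
- by apply/duality_gap_eq0; left; apply: feas sc.
- by apply/duality_gap_eq0; right; apply: feas sc.
Qed.
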